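(* Let $T>0$, let $f:[0,T]\times\mathcal{I}\times\mathbb{R}^n\to\mathcal{I}$ be Hausdorff continuous, let $x_0\in\mathcal{I}$, and consider the control system $\frac{dx}{dt}(t)=f(t,x(t),u(t))$, $t\in[0,T]$, $x(0)=x_0$, in the sense of (i)-differentiability. Consider the problem (IOCP): minimize $F(u):=\int_0^TL(t,x(t),u(t))\,dt$ subject to $u\in U_{ad}$, where $L:[0,T]\times\mathcal{I}\times\mathbb{R}^n\to\mathcal{I}$ and $x$ is the solution of the system corresponding to $u$; it is assumed that for each $u\in U_{ad}$ and corresponding $x$, $L(\cdot,x(\cdot),u(\cdot))$ is measurable and integrably bounded on $[0,T]$. Assume that (A1) $U_{ad}$ is the set of all continuous functions from $[0,T]$ to $\mathbb{R}^n$ with norm $\|u\|_{U_{ad}}=\max_{t\in[0,T]}\|u(t)\|_{\mathbb{R}^n}$; (A2) there exist $k_1>0$ and $k_2>0$ such that for all $t\in[0,T]$, $x_1,x_2\in\mathcal{I}$, $u_1,u_2\in\mathbb{R}^n$, $d_H(f(t,x_1,u_1),f(t,x_2,u_2))\le k_1d_H(x_1,x_2)+k_2\|u_1-u_2\|_{\mathbb{R}^n}$; (A3) $L$ is $\preccurlyeq$-lower semicontinuous on $[0,T]\times\mathcal{I}\times\mathbb{R}^n$; (A4) $[0,0]\preccurlyeq L(t,\zeta,\eta)$ for all $(t,\zeta,\eta)\in[0,T]\times\mathcal{I}\times\mathbb{R}^n$. Then for every given $\varepsilon>0$ there exists an $\varepsilon$-minimal solution of (IOCP), i.e., a $u_0\in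 U_{ad}$ such that for all $u\in U_{ad}$, $F(u)+[\varepsilon\|u-u_0\|_{U_{ad}},\varepsilon\|u-u_0\|_{U_{ad}}]\not\prec F(u_0)$.
   Context: $\mathcal{I}=\{[a,b]:a\le b,\ a,b\in\mathbb{R}\}$ is the set of closed bounded real intervals, with $[\underline{a},\overline{a}]+[\underline{b},\overline{b}]=[\underline{a}+\underline{b},\overline{a}+\overline{b}]$, $\lambda[\underline a,\overline a]=[\lambda\underline a,\lambda\overline a]$ if $\lambda\ge0$ and $[\lambda\overline a,\lambda\underline a]$ if $\lambda<0$, and Hausdorff distance $d_H([\underline{a},\overline{a}],[\underline{b},\overline{b}])=\max\{|\underline{a}-\underline{b}|,|\overline{a}-\overline{b}|\}$. Limits of intervals and Hausdorff continuity are with respect to $d_H$. $[\underline{a},\overline{a}]\preccurlyeq[\underline{b},\overline{b}]$ means $\underline{a}\le\underline{b}$, $\overline{a}\le\overline{b}$; $[\underline{a},\overline{a}]\prec[\underline{b},\overline{b}]$ means $\underline{a}<\underline{b}$, $\overline{a}<\overline{b}$; $\not\prec$ is its negation. A function $g:Y\to\mathcal{I}$ on a metric space $Y$ is $\preccurlyeq$-lower semicontinuous if $\{y\in Y:g(y)\preccurlyeq A\}$ is closed for every $A\in\mathcal{I}$; $\mathcal{I}$ carries $d_H$ and products carry the product metric. The Hukuhara difference $A\ominus_HB$ is the interval $C\in\mathcal{I}$ with $A=B+C$, if it exists. An interval-valued function $x$ of a real variable is (i)-differentiable at $t_0$ with derivative $\frac{dx}{dt}(t_0)\in\mathcal{I}$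 if for all sufficiently small $h>0$ the differences $x(t_0+h)\ominus_Hx(t_0)$ and $x(t_0)\ominus_Hx(t_0-h)$ exist and $\frac{dx}{dt}(t_0)=\lim_{h\to0_+}\frac{x(t_0+h)\ominus_Hx(t_0)}{h}=\lim_{h\to0_+}\frac{x(t_0)\ominus_Hx(t_0-h)}{h}$; it is (i)-differentiable on $[0,T]$ if this holds at every point (at an endpoint, only the one-sided difference that makes sense is required). A solution of the system is an (i)-differentiable $x:[0,T]\to\mathcal{I}$ satisfying it. Under (A2), each $u\in U_{ad}$ has a unique such solution, given by $x(t)=x_0+\int_0^tf(s,x(s),u(s))\,ds$ (known fact). For $g:[a,b]\to\mathcal{I}$, the Aumann integral is $\int_a^bg(t)\,dt=\{\int_a^b\gamma(t)\,dt:\gamma:[a,b]\to\mathbb{R}\text{ Lebesgue integrable},\ \gamma(t)\in g(t)\ \forall t\}$. $g$ is measurable if $\{t:g(t)\cap A\ne\emptyset\}$ is Lebesgue measurable for every closed $A\subset\mathbb{R}$, and integrably bounded if there is a Lebesgue integrable $k:[a,b]\to[0,+\infty)$ with $|y|\le k(t)$ for all $t$ and $y\in g(t)$; if both hold and $g=[\underline{g},\overline{g}]$ then $\int_a^bg\,dt=[\int_a^b\underline{g}\,dt,\int_a^b\overline{g}\,dt]$. *)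

(* Defs.v *)
From HB Require Import structures.
From mathcomp Require Import all_boot all_order all_algebra.
From mathcomp Require Import all_classical all_reals all_analysis.

Set Implicit Arguments.
Unset Strict Implicit.
Unset Printing Implicit Defensive.

Import Order.TTheory GRing.Theory Num.Theory.
Import numFieldNormedType.Exports.

Local Open Scope classical_set_scope.
Local Open Scope ring_scope.

(** ** Closed bounded intervals with the Hausdorff metric *)

Record cintv (R : realType) :=
  CIntv { endpoints : R * R ; _ : endpoints.1 <= endpoints.2 }.

HB.instance Definition _ (R : realType) := [isSub for @endpoints R].
HB.instance Definition _ (R : realType) := [Choice of cintv R by <:].

Section Intervals.
Context {R : realType}.
Implicit Types A B C : cintv R.

Definition lo A : R := (endpoints A).1.
Definition hi A : R := (endpoints A).2.

Lemma lo_le_hi A : lo A <= hi A.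
Proof. exact: (valP A). Qed.

Definition itv_set A : set R := [set y | lo A <= y <= hi A].

Definition mk_itv (a b : R) (ab : a <= b) : cintv R := @CIntv R (a, b) ab.

(* The degenerate interval [r, r]. *)
Definition itv1 (r : R) : cintv R := mk_itv (lexx r).

Lemma itv_add_subproof A B : lo A + lo B <= hi A + hi B.
Proof. by rewrite lerD ?lo_le_hi. Qed.

Definition itv_add A B : cintv R := mk_itv (itv_add_subproof A B).

Lemma itv_scale_subproof (l : R) A :
  (if 0 <= l then l * lo A else l * hi A) <=
  (if 0 <= l then l * hi A else l * lo A).
Proof.
case: ifPn => [l0|]; first by rewrite ler_wpM2l ?lo_le_hi.
by rewrite -ltNge => /ltW l0; rewrite ler_wnM2l ?lo_le_hi.
Qed.

Definition itv_scale (l : R) A : cintv R := mk_itv (itv_scale_subproof l A).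

Definition itv_dist A B : R :=
  Num.max `|lo A - lo B| `|hi A - hi B|.

Lemma itv_distxx A : itv_dist A A = 0.
Proof. by rewrite /itv_dist !subrr normr0 maxxx. Qed.

Lemma itv_dist_positivity A B : itv_dist A B = 0 -> A = B.
Proof.
move=> AB0; apply: val_inj; apply/eqP.
have /andP[l0 h0] : (`|lo A - lo B| <= 0) && (`|hi A - hi B| <= 0).
  by rewrite -ge_max -/(itv_dist A B) AB0.
have := l0; have := h0; rewrite !normr_le0 !subr_eq0 => /eqP hE /eqP lE.
rewrite /= [endpoints A]surjective_pairing [endpoints B]surjective_pairing.
by rewrite -/(lo A) -/(hi A) -/(lo B) -/(hi B) hE lE.
Qed.

Lemma itv_dist_sym A B : itv_dist A B = itv_dist B A.
Proof. by rewrite /itv_dist distrC [`|hi A - _|]distrC. Qed.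

Lemma itv_dist_triangle B A C : itv_dist A C <= itv_dist A B + itv_dist B C.
Proof.
rewrite {1}/itv_dist ge_max; apply/andP; split.
- rewrite (le_trans (ler_distD (lo B) _ _))// lerD//.
  + by rewrite /itv_dist le_max lexx.
  + by rewrite /itv_dist le_max lexx.
- rewrite (le_trans (ler_distD (hi B) _ _))// lerD//.
  + by rewrite /itv_dist le_max lexx orbT.
  + by rewrite /itv_dist le_max lexx orbT.
Qed.

HB.instance Definition _ := @isMetric.Build R (cintv R) itv_dist
  itv_distxx itv_dist_positivity itv_dist_sym itv_dist_triangle.

Definition itv_preceq A B : Prop := lo A <= lo B /\ hi A <= hi B.
Definition itv_prec A B : Prop := lo A < lo B /\ hi A < hi B.

(** ** Hukuhara difference and (i)-differentiability *)

Definition hdiff_exists A B : Prop := exists C, A = itv_add B C.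

(* [C] is unique when it exists; the value is junk otherwise. *)
Definition hdiff A B : cintv R := xget (itv1 0) [set C | A = itv_add B C].

Definition is_right_iderive (x : R -> cintv R) (t : R) (D : cintv R) : Prop :=
  (\forall h \near 0^'+, hdiff_exists (x (t + h)) (x t)) /\
  itv_scale h^-1 (hdiff (x (t + h)) (x t)) @[h --> 0^'+] --> D.

Definition is_left_iderive (x : R -> cintv R) (t : R) (D : cintv R) : Prop :=
  (\forall h \near 0^'+, hdiff_exists (x t) (x (t - h))) /\
  itv_scale h^-1 (hdiff (x t) (x (t - h))) @[h --> 0^'+] --> D.

(* (i)-derivative of [x : [0, T] -> I] at [t \in [0, T]], one-sided at the
   endpoints. *)
Definition is_iderive_on (T : R) (x : R -> cintv R) (t : R) (D : cintv R) :
    Prop :=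
  (t < T -> is_right_iderive x t D) /\ (0 < t -> is_left_iderive x t D).

(** ** Aumann integral *)

(* The reals with the sigma-algebra of Lebesgue (not only Borel) measurable
   sets, on which [completed_lebesgue_measure] lives. *)
Definition lebR : measurableType _ :=
  caratheodory_type ((wlength (idfun : R -> R))^*)%mu.

Definition leb : {measure set lebR -> \bar R} := @completed_lebesgue_measure R.

Definition lebesgue_integrable_on (a b : R) (g : R -> R) : Prop :=
  leb.-integrable `[a, b] (EFin \o g).

Definition lebesgue_integral_on (a b : R) (g : R -> R) : R :=
  Rintegral leb `[a, b] g.

Definition itv_measurable_on (a b : R) (g : R -> cintv R) : Prop :=
  forall A : set R, closed A ->
    measurable ([set t | a <= t <= b /\ itv_set (g t) `&` A !=set0] : set lebR).

Definition itv_integrably_bounded_on (a b : R) (g : R -> cintv R) : Prop :=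
  exists k : R -> R, [/\ forall t, a <= t <= b -> 0 <= k t,
    lebesgue_integrable_on a b k &
    forall t, a <= t <= b -> forall y, itv_set (g t) y -> `|y| <= k t].

Definition aumann_set (a b : R) (g : R -> cintv R) : set R :=
  [set r | exists gamma : R -> R, [/\ lebesgue_integrable_on a b gamma,
    forall t, a <= t <= b -> itv_set (g t) (gamma t) &
    r = lebesgue_integral_on a b gamma]].

(* The Aumann integral as an element of [cintv R]: the interval whose set of
   points is [aumann_set a b g]. It exists (and is unique) when [g] is
   measurable and integrably bounded; the value is junk otherwise. *)
Definition aumann_integral (a b : R) (g : R -> cintv R) : cintv R :=
  xget (itv1 0) [set J | itv_set J = aumann_set a b g].

End Intervals.

(** ** The control problem *)

Section Control.
Context {R : realType} {n : nat}.
Implicit Types (T : R) (u : R -> 'rV[R]_n) (x : R -> cintv R).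

(* Euclidean norm: the library norm on ['rV[R]_n] is the sup norm (it induces
   the same topology). *)
Definition euclid_norm (v : 'rV[R]_n) : R := Num.sqrt (\sum_i v 0 i ^+ 2).

(* Functions on [0, T] (resp. on [0, T] * I * R^n) are represented by total
   functions; all the notions below depend only on their values there. *)
Definition Uad T : set (R -> 'rV[R]_n) :=
  [set u | {within `[0, T], continuous u}].

Definition Uad_norm T u : R := sup [set euclid_norm (u t) | t in `[0, T]].

Definition txu_dom T : set (R * cintv R * 'rV[R]_n) :=
  [set p | 0 <= p.1.1 <= T].

Definition uncurry3 (f : R -> cintv R -> 'rV[R]_n -> cintv R) :
    R * cintv R * 'rV[R]_n -> cintv R :=
  fun p => f p.1.1 p.1.2 p.2.

Definition is_solution T (f : R -> cintv R -> 'rV[R]_n -> cintv R)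
    (x0 : cintv R) u x : Prop :=
  x 0 = x0 /\
  forall t, 0 <= t <= T -> is_iderive_on T x t (f t (x t) (u t)).

(* The solution corresponding to [u]; it exists and is unique on [0, T]
   when [f] is continuous and Lipschitz in the state. *)
Definition trajectory T (f : R -> cintv R -> 'rV[R]_n -> cintv R)
    (x0 : cintv R) u : R -> cintv R :=
  xget (fun=> x0) [set x | is_solution T f x0 u x].

Definition cost T (f : R -> cintv R -> 'rV[R]_n -> cintv R) (x0 : cintv R)
    (L : R -> cintv R -> 'rV[R]_n -> cintv R) u : cintv R :=
  aumann_integral 0 T (fun t => L t (trajectory T f x0 u t) (u t)).

Definition eps_minimal_solution T
    (f : R -> cintv R -> 'rV[R]_n -> cintv R) (x0 : cintv R)
    (L : R -> cintv R -> 'rV[R]_n -> cintv R) (eps : R)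
    (u0 : R -> 'rV[R]_n) : Prop :=
  Uad T u0 /\
  forall u, Uad T u ->
    ~ itv_prec
        (itv_add (cost T f x0 L u) (itv1 (eps * Uad_norm T (u \- u0))))
        (cost T f x0 L u0).

End Control.

(* Lower semicontinuity of the restriction of [g] to [Y], sublevel sets being
   closed in the subspace topology of [Y]. *)
Definition itv_lsc_on {R : realType} {M : topologicalType} (Y : set M)
    (g : M -> cintv R) : Prop :=
  forall A : cintv R, closed ([set y | itv_preceq (g y) A] : set (subspace Y)).

(* Main.v *)
Require Import Defs.
From mathcomp Require Import all_boot all_order all_algebra.
From mathcomp Require Import all_classical all_reals all_analysis.
From mathcomp Require Import measurable_realfun ring lra.

(** Only the upper endpoint of the cost matters. If
    F(u) + [eps d, eps d] were strictly below F(u0), then in particular the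
    upper endpoints would satisfy hi F(u) + eps d < hi F(u0), so it suffices
    to find u0 with hi F(u0) <= hi F(u) + eps d(u, u0) for all u, which is the
    weak form of Ekeland's variational principle ([ekeland]) for the
    real-valued functional hi F. The upper endpoint is the right choice because
    a lower endpoint never exceeds it: {hi L <= c} is the sublevel set
    {L <= [c, c]}, so hypothesis (A3) makes hi L lower semicontinuous
    ([hi_lsc]), whereas it gives no such control of lo L.

    The principle needs three things. The space of continuous controls is
    complete for the sup norm ([Uad_complete]). The functional is nonnegative
    by (A4). It is sequentially lower semicontinuous ([hi_cost_lsc]): the
    Aumann integral has the integral of hi L as its upper endpoint
    ([hi_aumann_integral]); the trajectories depend Lipschitz-continuously on
    the controls ([solution_stability]), hence the integrands are pointwise
    lower semicontinuous along a convergent sequence of controls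
    ([integrand_liminf]), and Fatou's lemma concludes.

    The trajectory of a control has to exist for all this to make sense. Both
    its existence ([solution_exists], by Picard iteration) and its stability
    come from a single estimate ([weighted_contraction]): passing from
    derivatives to primitives halves distances that are measured relative to
    the weight exp(2 k1 t). That estimate follows, endpoint by endpoint, from
    the mean value theorem, since an (i)-derivative is the pair of the ordinary
    derivatives of the endpoints ([iderive_endpoints]). *)

Set Implicit Arguments.
Unset Strict Implicit.
Unset Printing Implicit Defensive.

Import Order.TTheory GRing.Theory Num.Theory.
Import numFieldNormedType.Exports.

Local Open Scope classical_set_scope.
Local Open Scope ring_scope.

(** * Ekeland's variational principle *)

Lemma geo_small (R : realType) (C e : R) : 0 < e ->
  \forall n \near \oo, C * 2^-1 ^+ n < e.
Proof.
move=> e0; have : C * 2^-1 ^+ n @[n --> \oo] --> C * 0.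
  apply: cvgM; first exact: cvg_cst.
  by apply: cvg_expr; rewrite ger0_norm; lra.
rewrite mulr0 => /cvgrPdist_lt /(_ e e0); apply: filterS => n.
rewrite sub0r normrN; exact: le_lt_trans (ler_norm _).
Qed.

(** Weak form of Ekeland's principle. The points y with
    phi y + eps d(x, y) <= phi x form a set S x, and S is transitive. Choosing
    successively s n.+1 in S (s n) that nearly minimizes phi on S (s n) makes
    the sets S (s n) nested with diameters bounded by eps^-1 2^-n; their common
    point is the minimizer. Completeness is thus needed only for sequences with
    this rate, and lower semicontinuity only as sequential closedness of
    sublevel sets. *)
Lemma ekeland (R : realType) (X : Type) (D : set X) (d : X -> X -> R)
    (phi : X -> R) (eps : R) :
  0 < eps -> D !=set0 ->
  (forall x y, D x -> D y -> 0 <= d x y) ->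
  (forall x y z, D x -> D y -> D z -> d x z <= d x y + d y z) ->
  (forall x, D x -> d x x = 0) ->
  (forall s : nat -> X, (forall n, D (s n)) ->
     (forall n m, (n <= m)%N -> d (s n) (s m) <= eps^-1 * 2^-1 ^+ n) ->
     exists2 x, D x & forall e, 0 < e -> \forall n \near \oo, d (s n) x < e) ->
  (forall x, D x -> 0 <= phi x) ->
  (forall (s : nat -> X) x c, (forall n, D (s n)) -> D x ->
     (forall e, 0 < e -> \forall n \near \oo, d (s n) x < e) ->
     (forall n, phi (s n) <= c) -> phi x <= c) ->
  exists2 x0, D x0 & forall x, D x -> phi x0 <= phi x + eps * d x0 x.
Proof.
move=> e0 [a Da] d_ge0 d_tri dxx d_complete phi_ge0 phi_lsc.
pose S x := [set y | D y /\ phi y + eps * d x y <= phi x].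
have Sxx x : D x -> S x x by move=> Dx; split => //; rewrite dxx ?mulr0 ?addr0.
have Str x y z : D x -> S x y -> S y z -> S x z.
  move=> Dx [Dy yx] [Dz zy]; split => //.
  have := ler_wpM2l (ltW e0) (d_tri _ _ _ Dx Dy Dz); lra.
have step x k : D x -> exists y, S x y /\
    forall z, S x z -> phi y <= phi z + 2^-1 ^+ k.
  move=> Dx; set P := [set phi z | z in S x].
  have Pinf : has_inf P.
    split; first by exists (phi x), x => //; exact: Sxx.
    by exists 0 => _ [z [Dz _] <-]; exact: phi_ge0.
  have k0 : 0 < 2^-1 ^+ k :> R by rewrite exprn_gt0// invr_gt0.
  have [_ [y Sy <-] ylt] := inf_adherent k0 Pinf.
  exists y; split => // z Sz; apply: (le_trans (ltW ylt)); rewrite lerD2r.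
  by apply: ge_inf; [exact: Pinf.2|exists z].
have {step}[nxt nxtP] : exists nxt : X * nat -> X, forall p, D p.1 ->
    S p.1 (nxt p) /\ forall z, S p.1 z -> phi (nxt p) <= phi z + 2^-1 ^+ p.2.
  have h (p : X * nat) : exists y, D p.1 -> S p.1 y /\
      forall z, S p.1 z -> phi y <= phi z + 2^-1 ^+ p.2.
    have [Dx|nDx] := pselect (D p.1); last by exists a.
    by have [y yP] := step p.1 p.2 Dx; exists y.
  by exists (fun p => sval (cid (h p))) => p; exact: svalP (cid (h p)).
(* The tolerance 2^-n at rank n, including n = 0, is what makes S (s n) of
   diameter eps^-1 * 2^-n. *)
pose s := fix s n := if n is m.+1 then nxt (s m, n) else nxt (a, 0%N).
have Ds n : D (s n).
  elim: n => [|n ih]; first exact: (nxtP (a, 0%N) Da).1.1.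
  exact: (nxtP (s n, n.+1) ih).1.1.
have Sn n m : (n <= m)%N -> S (s n) (s m).
  elim: m => [|m ih]; first by rewrite leqn0 => /eqP ->; exact: Sxx.
  rewrite leq_eqVlt => /predU1P[->|]; first exact: Sxx.
  rewrite ltnS => /ih nm; apply: Str nm _ => //.
  exact: (nxtP (s m, m.+1) (Ds m)).1.
have near_min n z : S (s n) z -> phi (s n) <= phi z + 2^-1 ^+ n.
  case: n => [|n] /= Sz.
    apply: (nxtP (a, 0%N) Da).2; apply: Str Sz => //.
    exact: (nxtP (a, 0%N) Da).1.
  have /= [S1 S2] := nxtP (s n, n.+1) (Ds n).
  exact: S2 (Str _ _ _ (Ds n) S1 Sz).
have s_diam n z : S (s n) z -> d (s n) z <= eps^-1 * 2^-1 ^+ n.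
  move=> Sz; have := near_min n z Sz; have [_ ] := Sz => h1 h2.
  by rewrite ler_pdivlMl//; lra.
have [x Dx sx] := d_complete s Ds (fun n m nm => s_diam n _ (Sn n m nm)).
exists x => // y Dy.
(* The limit lies in every S (s n): for m large, phi (s m) is at most
   phi (s n) - eps d(s n, x) + e, a sublevel condition that passes to the
   limit. *)
have Sx n : S (s n) x.
  split=> //; apply/ler_addgt0Pr => e epos.
  have e1 : 0 < eps^-1 * e by rewrite mulr_gt0// invr_gt0.
  have [N _ NP] := sx _ e1.
  rewrite -lerBrDr; apply: (phi_lsc (fun m => s (n + N + m)%N)) => //.
    move=> e' e'0; have [N' _ N'P] := sx _ e'0.
    exists N' => // m /= N'm; apply: N'P => /=.
    by rewrite (leq_trans N'm)// leq_addl.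
  move=> m /=; set p := (n + N + m)%N.
  have np : (n <= p)%N by rewrite /p -addnA leq_addr.
  have Np : (N <= p)%N by rewrite /p addnAC leq_addl.
  have [_ h1] := Sn n p np.
  have h2 := ler_wpM2l (ltW e0) (d_tri _ _ _ (Ds n) (Ds p) Dx).
  have := NP p Np; rewrite /= ltr_pdivlMl// => h3.
  lra.
rewrite leNgt; apply/negP => ylt.
(* A y contradicting minimality would belong to every S (s n) as well, where
   phi (s n) is almost minimal, whence phi x <= phi y. *)
have Sy n : S (s n) y by apply: Str (Sx n) _ => //; split => //; exact: ltW.
have eq_xy : phi x <= phi y.
  apply/ler_addgt0Pr => e epos.
  have [N _ /(_ N (leqnn _)) /=] := geo_small 1 epos; rewrite mul1r => Ne.
  have := near_min N y (Sy N); have [_] := Sx N.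
  have := mulr_ge0 (ltW e0) (d_ge0 _ _ (Ds N) Dx); lra.
by have := mulr_ge0 (ltW e0) (d_ge0 _ _ Dx Dy); lra.
Qed.

(** * Uniform limits and the Euclidean norm *)

(** Used for controls and for the endpoints of Picard iterates. The bound
    2 (r n) instead of r n accounts for balls being open: the limit of points
    of a ball is only in its closure. *)
Lemma uniform_limit_within (R : realType) (V : completePseudoMetricType R)
    (A : set R) (s : nat -> R -> V) (r : nat -> R) :
  (forall n, 0 < r n) ->
  (forall e, 0 < e -> \forall n \near \oo, r n < e) ->
  (forall n m t, (n <= m)%N -> A t -> ball (s n t) (r n) (s m t)) ->
  (forall n, {within A, continuous (s n)}) ->
  exists2 g : R -> V, {within A, continuous g} &
    forall n t, A t -> ball (s n t) (r n + r n) (g t).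
Proof.
move=> r_gt0 r0 scauchy scont.
pose g t : V := lim (s n t @[n --> \oo]).
have sg n t : A t -> ball (s n t) (r n + r n) (g t).
  move=> At; have sgt : s n t @[n --> \oo] --> g t.
    apply: cauchy_cvg; apply: cauchy_exP => e e0.
    have [N _ /(_ N (leqnn _)) /= rN] := r0 e e0.
    exists (s N t); exists N => // m /= Nm.
    by apply: (le_ball (ltW rN)); exact: scauchy.
  have [N _ NP] := (@cvg_ballP _ _ _ _ _ _ _).1 sgt _ (r_gt0 n).
  pose m := maxn n N.
  apply: (ball_triangle (scauchy n m t (leq_maxl _ _) At)).
  by apply: ball_sym; apply: NP => /=; exact: leq_maxr.
exists g => //; apply/subspace_continuousP => t At.
apply/cvg_ballP => e e0.
have [n _ /(_ n (leqnn _)) /= rn] := r0 (e / 5) (divr_gt0 e0 (ltr0n _ 5)).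
have /subspace_continuousP/(_ t At)/cvg_ballP/(_ _ (r_gt0 n)) := scont n.
rewrite !near_withinE; apply: filterS => t' st' At'.
have := ball_triangle (ball_triangle (ball_sym (sg n t At)) (st' At'))
  (sg n t' At').
by apply: le_ball; lra.
Qed.

(** Cauchy-Schwarz: the sum of the squares (x a_i - y b_i)^2 is nonnegative for
    all x and y, in particular at x = B, y = c, where it is B (A B - c^2). *)
Lemma sum_mul_le_sqrt (R : realType) (I : finType) (a b : I -> R) :
  \sum_i a i * b i <=
  Num.sqrt (\sum_i a i ^+ 2) * Num.sqrt (\sum_i b i ^+ 2).
Proof.
set A := \sum_i a i ^+ 2; set B := \sum_i b i ^+ 2; set c := \sum_i _.
have A0 : 0 <= A by apply: sumr_ge0 => i _; exact: sqr_ge0.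
have B0 : 0 <= B by apply: sumr_ge0 => i _; exact: sqr_ge0.
suff c2 : c ^+ 2 <= A * B.
  rewrite -sqrtrM// (le_trans (ler_norm c))// -sqrtr_sqr; exact: ler_wsqrtr.
have quad x y : 0 <= x ^+ 2 * A - 2 * x * y * c + y ^+ 2 * B.
  rewrite /A /B /c !mulr_sumr -sumrB -big_split /=.
  apply: sumr_ge0 => i _.
  rewrite (_ : _ + _ = (x * a i - y * b i) ^+ 2); last by ring.
  exact: sqr_ge0.
have [B_eq0|Bn0] := eqVneq B 0; last first.
  have Bpos : 0 < B by rewrite lt_neqAle eq_sym Bn0.
  have := quad B c.
  rewrite (_ : _ + _ = B * (A * B - c ^+ 2)); last by ring.
  by rewrite pmulr_rge0// subr_ge0.
(* With B = 0 the form is affine in y, hence c = 0: otherwise this choice of y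
   gives it the value -1. *)
have [->|c0] := eqVneq c 0; first by rewrite expr0n mulr_ge0.
have := quad 1 ((A + 1) / (2 * c)); rewrite B_eq0.
rewrite (_ : _ + _ = - 1) ?oppr_ge0 ?ler10//; by field.
Qed.

(** The topology of row vectors comes from the sup norm; the two-sided
    comparison below transfers limits and completeness to the Euclidean norm. *)
Section EuclideanNorm.
Context {R : realType} {n : nat}.
Implicit Types v w : 'rV[R]_n.

Lemma euclid_norm_ge0 v : 0 <= euclid_norm v.
Proof. exact: sqrtr_ge0. Qed.

Lemma euclid_norm0 : euclid_norm (0 : 'rV[R]_n) = 0.
Proof.
by rewrite /euclid_norm big1 ?sqrtr0// => i _; rewrite mxE expr0n.
Qed.

Lemma euclid_normN v : euclid_norm (- v) = euclid_norm v.
Proof.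
by congr Num.sqrt; apply: eq_bigr => i _; rewrite mxE sqrrN.
Qed.

Lemma euclid_normD v w : euclid_norm (v + w) <= euclid_norm v + euclid_norm w.
Proof.
rewrite -(@ler_sqr R) ?nnegrE ?addr_ge0 ?euclid_norm_ge0//.
have sq (x : 'rV[R]_n) : euclid_norm x ^+ 2 = \sum_i x 0 i ^+ 2.
  by rewrite sqr_sqrtr//; apply: sumr_ge0 => i _; exact: sqr_ge0.
rewrite sqrrD !sq.
have -> : \sum_i (v + w) 0 i ^+ 2 =
    \sum_i v 0 i ^+ 2 + (\sum_i v 0 i * w 0 i) *+ 2 + \sum_i w 0 i ^+ 2.
  rewrite -sumrMnl -!big_split /=; apply: eq_bigr => i _.
  by rewrite mxE sqrrD.
by rewrite lerD2r lerD2l lerMn2r; apply: sum_mul_le_sqrt.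
Qed.

Lemma norm_le_euclid_norm v : `|v| <= euclid_norm v.
Proof.
rewrite -[`|v|]/(mx_norm v) mx_normrE; apply: bigmax_le; first exact: euclid_norm_ge0.
move=> [i j] _ /=; rewrite ord1 -sqrtr_sqr; apply: ler_wsqrtr.
by rewrite (bigD1 j)//= lerDl; apply: sumr_ge0 => k _; exact: sqr_ge0.
Qed.

Lemma euclid_norm_le_norm v : euclid_norm v <= n%:R * `|v|.
Proof.
have nv0 : 0 <= n%:R * `|v| by rewrite mulr_ge0.
rewrite -(ger0_norm nv0) -sqrtr_sqr; apply: ler_wsqrtr.
have coord i : v 0 i ^+ 2 <= `|v| ^+ 2.
  rewrite -real_normK ?num_real// ler_sqr ?nnegrE//.
  rewrite -[`|v|]/(mx_norm v) mx_normrE.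
  by apply: (le_bigmax _ (fun ij => `|v ij.1 ij.2|) (0, i)).
apply: (@le_trans _ _ (\sum_(i < n) `|v| ^+ 2)); first exact: ler_sum.
rewrite sumr_const card_ord -[_ *+ n]mulr_natl exprMn ler_wpM2r ?sqr_ge0//.
by rewrite -natrX ler_nat; case: n => // k; rewrite leq_pmulr.
Qed.

End EuclideanNorm.

(** * The space of controls *)

Section ControlSpace.
Context {R : realType} {n : nat} (T : R).
Hypothesis T_gt0 : 0 < T.
Implicit Types u v w : R -> 'rV[R]_n.

Lemma euclid_norm_continuous : continuous (@euclid_norm R n).
Proof.
move=> v; apply/(@cvgrPdist_lt _ _ _ (nbhs v)) => e e0.
(* The factor n.+1 rather than n keeps the division valid in dimension 0. *)
have n0 : 0 < n.+1%:R :> R by [].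
have e1 : 0 < e / n.+1%:R by exact: divr_gt0.
apply: (@filterS _ (nbhs v) _ _ _ _ (nbhsx_ballx v _ e1)) => w.
rewrite -ball_normE /= ltr_pdivlMr// mulrC => vw.
have d_le (a b : 'rV[R]_n) : euclid_norm a - euclid_norm b <= euclid_norm (a - b).
  by rewrite lerBlDr (le_trans _ (euclid_normD _ _))// subrK.
have vw' : euclid_norm (v - w) <= n.+1%:R * `|v - w|.
  by rewrite (le_trans (euclid_norm_le_norm _))// ler_wpM2r// ler_nat.
have wv' : euclid_norm (w - v) <= n.+1%:R * `|v - w|.
  by rewrite -euclid_normN opprB.
have := d_le v w; have := d_le w v.
by rewrite ltr_norml; move=> h1 h2; apply/andP; split; lra.
Qed.

Lemma UadB u v : Uad T u -> Uad T v -> Uad T (u \- v).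
Proof. by move=> uU vU t; apply: cvgB; [exact: uU|exact: vU]. Qed.

(** The supremum bounds the values only because it is finite: a continuous
    function on [0, T] attains its maximum. *)
Lemma le_Uad_norm u t : Uad T u -> 0 <= t <= T ->
  euclid_norm (u t) <= Uad_norm T u.
Proof.
move=> uU tT; apply: ub_le_sup; last by exists t => //=; rewrite in_itv.
have [||c _ cmax] := @EVT_max _ (@euclid_norm R n \o u) 0 T; first exact: ltW.
  move=> s; apply: (continuous_comp (uU s)); exact: euclid_norm_continuous.
by exists (euclid_norm (u c)) => _ [s sT <-]; exact: cmax.
Qed.

Lemma Uad_norm_le u (c : R) :
  (forall t, 0 <= t <= T -> euclid_norm (u t) <= c) -> Uad_norm T u <= c.
Proof.
move=> uc; apply: ge_sup; last first.
  by move=> _ [t tT <-]; apply: uc; rewrite /= in_itv in tT.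
by exists (euclid_norm (u 0)), 0 => //=; rewrite in_itv /= lexx ltW.
Qed.

Lemma Uad_norm_ge0 u : Uad T u -> 0 <= Uad_norm T u.
Proof.
move=> uU; apply: le_trans (le_Uad_norm (t := 0) uU _); first exact: euclid_norm_ge0.
by rewrite lexx ltW.
Qed.

Lemma Uad_norm_triangle u v w : Uad T u -> Uad T v -> Uad T w ->
  Uad_norm T (w \- u) <= Uad_norm T (v \- u) + Uad_norm T (w \- v).
Proof.
move=> uU vU wU; apply: Uad_norm_le => t tT /=.
rewrite (_ : w t - u t = v t - u t + (w t - v t)); last first.
  by rewrite [RHS]addrC addrA subrK.
rewrite (le_trans (euclid_normD _ _))// lerD//.
  exact: (le_Uad_norm (UadB vU uU) tT).
exact: (le_Uad_norm (UadB wU vU) tT).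
Qed.

Lemma Uad_norm_xx u : Uad_norm T (u \- u) = 0.
Proof.
rewrite /Uad_norm (_ : [set _ | _ in _] = [set 0]) ?sup1//.
apply/seteqP; split => [_ [t _ <-]|_ ->] /=; first by rewrite subrr euclid_norm0.
exists 0; first by rewrite /= in_itv /= lexx ltW.
by rewrite subrr euclid_norm0.
Qed.

(** Completeness in the form required by [ekeland]: the Cauchy rate is
    geometric. *)
Lemma Uad_complete (C : R) (s : nat -> R -> 'rV[R]_n) : 0 < C ->
  (forall k, Uad T (s k)) ->
  (forall k m, (k <= m)%N -> Uad_norm T (s m \- s k) <= C * 2^-1 ^+ k) ->
  exists2 u, Uad T u &
    forall e, 0 < e -> \forall k \near \oo, Uad_norm T (u \- s k) < e.
Proof.
move=> C0 sU scauchy.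
have geo0 k : 0 < 2^-1 ^+ k :> R by rewrite exprn_gt0 ?invr_gt0.
have [|e e0|k m t km tT|k|u uU su] := @uniform_limit_within R 'rV[R]_n `[0, T] s
  (fun k => 2 * C * 2^-1 ^+ k).
- by move=> k; rewrite !mulr_gt0.
- exact: geo_small.
- rewrite -ball_normE /= distrC (le_lt_trans (norm_le_euclid_norm _))//.
  have tT' : 0 <= t <= T by rewrite /= in_itv in tT.
  rewrite (le_lt_trans (le_Uad_norm (UadB (sU m) (sU k)) tT'))//.
  by rewrite (le_lt_trans (scauchy k m km))// ltr_pM2r// ltr_pMl// ltr1n.
- exact: sU.
exists u => // e e0.
have e2 : 0 < e / 2 by lra.
have := geo_small (n.+1%:R * (2 * C + 2 * C)) e2.
apply: filterS => k ke; apply: le_lt_trans (_ : e / 2 < e); last by lra.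
apply: Uad_norm_le => t tT; apply: ltW; apply: le_lt_trans ke.
rewrite (le_trans (euclid_norm_le_norm _))// -mulrA ler_pM ?ler_nat//.
have tT' : `[0, T]%classic t by rewrite /= in_itv.
have := su k t tT'.
rewrite -ball_normE /= distrC => ?; lra.
Qed.

End ControlSpace.

(** * Intervals and Hukuhara difference quotients *)

Definition right_quot_cvg (R : realType) (g : R -> R) (t l : R) : Prop :=
  h^-1 * (g (t + h) - g t) @[h --> 0^'+] --> l.

Definition left_quot_cvg (R : realType) (g : R -> R) (t l : R) : Prop :=
  h^-1 * (g t - g (t - h)) @[h --> 0^'+] --> l.

Section IntervalMetric.
Context {R : realType}.
Implicit Types (A B C D : cintv R) (x : R -> cintv R).

Lemma lo_dist A B : `|lo A - lo B| <= itv_dist A B.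
Proof. by rewrite /itv_dist le_max lexx. Qed.

Lemma hi_dist A B : `|hi A - hi B| <= itv_dist A B.
Proof. by rewrite /itv_dist le_max lexx orbT. Qed.

Lemma ball_itvE A e B : ball A e B = (itv_dist A B < e) :> Prop.
Proof. by []. Qed.

(** The Hausdorff metric is the sup metric on pairs of endpoints. *)
Lemma cvg_itvP (U : Type) (F : set_system U) (FF : Filter F)
    (x : U -> cintv R) D :
  x u @[u --> F] --> D <->
  (lo (x u) @[u --> F] --> lo D) /\ (hi (x u) @[u --> F] --> hi D).
Proof.
split=> [/cvg_ballP xD|[/cvgrPdist_lt loD /cvgrPdist_lt hiD]].
  split; apply/cvgrPdist_lt => e e0; apply: filterS (xD e e0) => u.
    exact/le_lt_trans/lo_dist.
  exact/le_lt_trans/hi_dist.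
apply/cvg_ballP => e e0; apply: filterS2 (loD e e0) (hiD e e0) => u lo_e hi_e.
by rewrite ball_itvE /itv_dist gt_max lo_e.
Qed.

Lemma lo_continuous : continuous (@lo R).
Proof. by move=> A; have /cvg_itvP[] := @cvg_id _ (nbhs A). Qed.

Lemma hi_continuous : continuous (@hi R).
Proof. by move=> A; have /cvg_itvP[] := @cvg_id _ (nbhs A). Qed.

Lemma itv_eqP A B : lo A = lo B -> hi A = hi B -> A = B.
Proof.
move=> loE hiE; apply: itv_dist_positivity.
by rewrite /itv_dist loE hiE !subrr normr0 maxxx.
Qed.

(** The only candidate for the difference has the differences of the endpoints
    as endpoints, and it is an interval iff these are ordered. *)
Lemma hdiff_existsP A B : hdiff_exists A B <-> hi B - lo B <= hi A - lo A.
Proof.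
split=> [[C ->]|AB]; first by rewrite /= ; have := lo_le_hi C; rewrite /lo/hi/=; lra.
have C_le : lo A - lo B <= hi A - hi B by lra.
exists (mk_itv C_le); apply: itv_eqP; rewrite /lo/hi/= -/(lo _) -/(hi _) addrC subrK//.
Qed.

Lemma hdiffE A B : hdiff_exists A B ->
  (lo (hdiff A B) = lo A - lo B) /\ (hi (hdiff A B) = hi A - hi B).
Proof.
move=> [C AC]; have -> : hdiff A B = C.
  apply: xget_subset1 => // C1 C2 /= E1 E2.
  move: E1; rewrite E2 => E.
  apply: itv_eqP.
    by have := congr1 lo E; rewrite /lo/= => /addrI.
  by have := congr1 hi E; rewrite /hi/= => /addrI.
by rewrite AC /lo/hi/= -/(lo _) -/(hi _); split; rewrite addrC addKr.
Qed.

Lemma itv_scaleE (l : R) A : 0 <= l ->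
  (lo (itv_scale l A) = l * lo A) /\ (hi (itv_scale l A) = l * hi A).
Proof. by move=> l0; rewrite /lo /hi /= l0. Qed.

(** Reduces (i)-differentiation to real one-sided derivatives: once the
    differences exist, subtraction and scaling by h^-1 > 0 act endpointwise. *)
Lemma hdiff_quot_cvgP (P Q : R -> cintv R) D :
  (\forall h \near 0^'+, hdiff_exists (P h) (Q h)) ->
  (itv_scale h^-1 (hdiff (P h) (Q h)) @[h --> 0^'+] --> D <->
   (h^-1 * (lo (P h) - lo (Q h)) @[h --> 0^'+] --> lo D) /\
   (h^-1 * (hi (P h) - hi (Q h)) @[h --> 0^'+] --> hi D)).
Proof.
move=> ex.
have E : \forall h \near (0 : R)^'+,
    lo (itv_scale h^-1 (hdiff (P h) (Q h))) = h^-1 * (lo (P h) - lo (Q h)) /\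
    hi (itv_scale h^-1 (hdiff (P h) (Q h))) = h^-1 * (hi (P h) - hi (Q h)).
  apply: filterS2 ex (nbhs_right_gt 0) => h exh h0.
  have hV_ge0 : 0 <= h^-1 by rewrite invr_ge0 ltW.
  have [-> ->] := itv_scaleE (hdiff (P h) (Q h)) hV_ge0.
  by have [-> ->] := hdiffE exh.
rewrite cvg_itvP; split=> -[loD hiD]; split.
- by apply: cvg_trans loD; apply: near_eq_cvg; apply: filterS E => h [].
- by apply: cvg_trans hiD; apply: near_eq_cvg; apply: filterS E => h [].
- by apply: cvg_trans loD; apply: near_eq_cvg; apply: filterS E => h [].
- by apply: cvg_trans hiD; apply: near_eq_cvg; apply: filterS E => h [].
Qed.

End IntervalMetric.

(** * Interval-valued primitives *)

Section OneSidedDerivatives.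
Context {R : realType}.
Implicit Types (g : R -> R) (t l : R).

Lemma is_derive_of_quot g t l :
  right_quot_cvg g t l -> left_quot_cvg g t l -> is_derive t 1 g l.
Proof.
move=> gr gl.
suff gd : h^-1 *: ((g \o shift t) (h *: 1) - g t) @[h --> 0^'] --> l.
  by apply: DeriveDef; [apply/cvg_ex; exists l|exact: cvg_lim gd].
apply: (@cvg_at_right_left_dnbhs _ R^o).
  apply: cvg_trans gr; apply: near_eq_cvg; near=> h.
  by rewrite /= /GRing.scale /= mulr1 (addrC h).
apply/cvg_at_leftNP; rewrite oppr0.
apply: cvg_trans gl; apply: near_eq_cvg; near=> h.
rewrite /= /GRing.scale /= mulr1 (addrC (- h)) invrN mulNr -mulrN opprB//.
Unshelve. all: by end_near. Qed.

Lemma quot_of_is_derive g t l :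
  is_derive t 1 g l -> right_quot_cvg g t l /\ left_quot_cvg g t l.
Proof.
move=> [gd gl].
have gq : h^-1 *: ((g \o shift t) (h *: 1) - g t) @[h --> 0^'] --> l.
  by rewrite -gl; exact: gd.
split.
  have := cvg_dnbhs_at_right gq.
  apply: cvg_trans; apply: near_eq_cvg; near=> h.
  by rewrite /= /GRing.scale /= mulr1 (addrC h).
have := cvg_dnbhs_at_left gq => /cvg_at_leftNP; rewrite oppr0.
apply: cvg_trans; apply: near_eq_cvg; near=> h.
rewrite /= /GRing.scale /= mulr1 (addrC (- h)) invrN mulNr -mulrN opprB//.
Unshelve. all: by end_near. Qed.

(** A convergent difference quotient forces its numerator to vanish, which
    gives one-sided continuity from one-sided derivatives. *)
Lemma quot_cvg0 (w : R -> R) l : h^-1 * w h @[h --> 0^'+] --> l ->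
  w h @[h --> 0^'+] --> 0.
Proof.
move=> wl; have : h * (h^-1 * w h) @[h --> 0^'+] --> 0 * l.
  apply: cvgM wl; apply: cvg_at_right_filter; exact: cvg_id.
rewrite mul0r; apply: cvg_trans; apply: near_eq_cvg.
by apply: filterS (nbhs_right_gt 0) => h h0; rewrite mulrA divff ?mul1r ?gt_eqF.
Qed.

(** Continuity on the closed interval, endpoints included, as required by the
    mean value theorem. *)
Lemma within_continuous_of_quot (T : R) g :
  (forall t, 0 <= t <= T -> t < T -> exists l, right_quot_cvg g t l) ->
  (forall t, 0 <= t <= T -> 0 < t -> exists l, left_quot_cvg g t l) ->
  {within `[0, T], continuous g}.
Proof.
move=> gr gl; apply/subspace_continuousP => t /= tT.
have tT' : 0 <= t <= T by rewrite in_itv in tT.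
have [t0 tleT] : 0 <= t /\ t <= T by apply/andP.
apply/cvgrPdist_lt => e e0; rewrite !near_withinE.
pose P s := 0 <= s <= T -> `|g t - g s| < e.
have right_near : \forall h \near 0^'+, P (t + h).
  have [tltT|Tt] := ltP t T.
    have [l /quot_cvg0/cvgrPdist_lt/(_ e e0)] := gr t tT' tltT.
    by apply: filterS => h; rewrite sub0r opprB => + _.
  by apply: filterS (nbhs_right_gt 0) => h h0 /andP[_]; lra.
have left_near : \forall h \near 0^'+, P (t - h).
  have [tgt0|t_le0] := ltP 0 t.
    have [l /quot_cvg0/cvgrPdist_lt/(_ e e0)] := gl t tT' tgt0.
    by apply: filterS => h; rewrite sub0r normrN => + _.
  by apply: filterS (nbhs_right_gt 0) => h h0 /andP[]; lra.
have /nbhs_ballP[d /= d0 dP] :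
    nbhs (0 : R) [set h | 0 < h -> P (t + h) /\ P (t - h)].
  exact: filterI right_near left_near.
apply/nbhs_ballP; exists d => //= s; rewrite /ball /= => ts sT.
have {sT} : 0 <= s <= T by rewrite /= in_itv in sT.
have [st|st|->] := ltgtP s t; last by rewrite subrr normr0.
- rewrite (_ : s = t - (t - s)); last by ring.
  move: (dP (t - s)); rewrite /ball /= sub0r normrN => /(_ ts).
  by rewrite subr_gt0 => /(_ st)[_].
- rewrite (_ : s = t + (s - t)); last by ring.
  move: (dP (s - t)); rewrite /ball /= sub0r normrN distrC => /(_ ts).
  by rewrite subr_gt0 => /(_ st)[].
Qed.

Lemma le_of_derive_ge0 (T : R) (g dg : R -> R) :
  (forall t, 0 < t < T -> is_derive t 1 g (dg t)) ->
  (forall t, 0 < t < T -> 0 <= dg t) ->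
  {within `[0, T], continuous g} ->
  forall s t, 0 <= s -> s <= t -> t <= T -> g s <= g t.
Proof.
move=> gd dg0 gc s t s0 st tT.
move: st; rewrite le_eqVlt => /predU1P[->//|st].
have [r||c] := MVT st (f := g) (df := dg).
- by rewrite in_itv /= => /andP[sr rt]; apply: gd; lra.
- apply: continuous_subspaceW gc => r /=.
  by rewrite !in_itv /= => /andP[? ?]; apply/andP; lra.
rewrite in_itv /= => /andP[sc ct] gE.
rewrite -subr_ge0 gE mulr_ge0 ?subr_ge0 ?(ltW st)// dg0//; lra.
Qed.

(** Integrating over [-1, t] rather than [0, t] makes the primitive
    differentiable at 0 on both sides. *)
Lemma primitive_exists g : continuous g ->
  exists2 G : R -> R, G 0 = 0 & forall t, 0 <= t -> is_derive t 1 G (g t).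
Proof.
move=> gc.
pose F x := \int[lebesgue_measure]_(s in [set` Interval (BLeft (-1)) (BRight x)]) g s.
exists (fun t => F t - F 0); first by rewrite subrr.
move=> t t0.
have [||||Fd FE] := @continuous_FTC1 R g (BLeft (-1)) t (t + 1).
- by rewrite ltrDl.
- apply: continuous_compact_integrable; first exact: segment_compact.
  exact: continuous_subspaceT.
- by rewrite /= lte_fin; lra.
- exact: gc.
have Fg : is_derive t 1 F (g t).
  by apply: DeriveDef => //; rewrite -derive1E.
have := is_deriveB Fg (is_derive_cst (F 0) t 1).
by rewrite subr0.
Qed.

End OneSidedDerivatives.

Section IntervalDerivatives.
Context {R : realType} (T : R).
Hypothesis T_gt0 : 0 < T.
Implicit Types x y F G : R -> cintv R.

(** The two halves of an (i)-derivative are the one-sided derivatives of the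
    endpoints; inside ]0, T[ they agree and form an ordinary derivative. *)
Lemma iderive_endpoints x F :
  (forall t, 0 <= t <= T -> is_iderive_on T x t (F t)) ->
  [/\ {within `[0, T], continuous (@lo R \o x)},
    {within `[0, T], continuous (@hi R \o x)},
    forall t, 0 < t < T -> is_derive t 1 (@lo R \o x) (lo (F t)) &
    forall t, 0 < t < T -> is_derive t 1 (@hi R \o x) (hi (F t))].
Proof.
move=> xF.
have xr t : 0 <= t <= T -> t < T -> right_quot_cvg (@lo R \o x) t (lo (F t)) /\
    right_quot_cvg (@hi R \o x) t (hi (F t)).
  by move=> tT tlt; have [/(_ tlt)[ex /(hdiff_quot_cvgP _ ex)]] := xF t tT.
have xl t : 0 <= t <= T -> 0 < t -> left_quot_cvg (@lo R \o x) t (lo (F t)) /\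
    left_quot_cvg (@hi R \o x) t (hi (F t)).
  by move=> tT t0; have [_ /(_ t0)[ex /(hdiff_quot_cvgP _ ex)]] := xF t tT.
split.
- apply: within_continuous_of_quot => t tT ht.
    by exists (lo (F t)); case: (xr t tT ht).
  by exists (lo (F t)); case: (xl t tT ht).
- apply: within_continuous_of_quot => t tT ht.
    by exists (hi (F t)); case: (xr t tT ht).
  by exists (hi (F t)); case: (xl t tT ht).
- move=> t /andP[t0 tlt]; have tT : 0 <= t <= T by apply/andP; lra.
  by apply: is_derive_of_quot; [case: (xr t tT tlt)|case: (xl t tT t0)].
- move=> t /andP[t0 tlt]; have tT : 0 <= t <= T by apply/andP; lra.
  by apply: is_derive_of_quot; [case: (xr t tT tlt)|case: (xl t tT t0)].
Qed.

Lemma iderive_continuous x F :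
  (forall t, 0 <= t <= T -> is_iderive_on T x t (F t)) ->
  {within `[0, T], continuous x}.
Proof.
move=> /iderive_endpoints[loc hic _ _]; apply/subspace_continuousP => t tT.
apply/cvg_itvP; split; first by move/subspace_continuousP : loc => /(_ t tT).
by move/subspace_continuousP : hic => /(_ t tT).
Qed.

(** Mean value inequality. Each of the four differences +-(lo x - lo y),
    +-(hi x - hi y) has a derivative at most dpsi, so psi minus it is
    nondecreasing. *)
Lemma dist_le_of_iderive x y F G (psi dpsi : R -> R) :
  (forall t, 0 <= t <= T -> is_iderive_on T x t (F t)) ->
  (forall t, 0 <= t <= T -> is_iderive_on T y t (G t)) ->
  x 0 = y 0 ->
  (forall t : R, is_derive t 1 psi (dpsi t)) ->
  (forall t, 0 <= t <= T -> itv_dist (F t) (G t) <= dpsi t) ->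
  forall t, 0 <= t <= T -> itv_dist (x t) (y t) <= psi t - psi 0.
Proof.
move=> /iderive_endpoints[xlc xhc xl xh] /iderive_endpoints[ylc yhc yl yh] xy0.
move=> psid FG t /andP[t0 tT].
have psic : {within `[0, T], continuous psi}.
  by apply: derivable_within_continuous => s _; have [] := psid s.
have endpoint_le (a b da db : R -> R) :
    {within `[0, T], continuous a} -> {within `[0, T], continuous b} ->
    (forall s, 0 < s < T -> is_derive s 1 a (da s)) ->
    (forall s, 0 < s < T -> is_derive s 1 b (db s)) ->
    (forall s, 0 <= s <= T -> da s - db s <= dpsi s) -> a 0 = b 0 ->
    a t - b t <= psi t - psi 0.
  move=> ac bc ad bd dab ab0.
  pose q s := psi s - (a s - b s).
  have qd s : 0 < s < T -> is_derive s 1 q (dpsi s - (da s - db s)).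
    by move=> sT; exact: is_deriveB (psid s) (is_deriveB (ad s sT) (bd s sT)).
  have qc : {within `[0, T], continuous q}.
    by move=> s; apply: cvgB; [exact: psic|apply: cvgB; [exact: ac|exact: bc]].
  have dq_ge0 s : 0 < s < T -> 0 <= dpsi s - (da s - db s).
    move=> /andP[s0 sT]; rewrite subr_ge0; apply: dab; apply/andP; lra.
  have := le_of_derive_ge0 qd dq_ge0 qc (lexx 0) t0 tT.
  by rewrite /q ab0; lra.
have loFG s : 0 <= s <= T -> `|lo (F s) - lo (G s)| <= dpsi s.
  by move=> sT; exact: le_trans (lo_dist _ _) (FG s sT).
have hiFG s : 0 <= s <= T -> `|hi (F s) - hi (G s)| <= dpsi s.
  by move=> sT; exact: le_trans (hi_dist _ _) (FG s sT).
have lo1 := endpoint_le _ _ _ _ xlc ylc xl yl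
  (fun s sT => le_trans (ler_norm _) (loFG s sT)) (congr1 (@lo R) xy0).
have hi1 := endpoint_le _ _ _ _ xhc yhc xh yh
  (fun s sT => le_trans (ler_norm _) (hiFG s sT)) (congr1 (@hi R) xy0).
have lo2 : lo (y t) - lo (x t) <= psi t - psi 0.
  apply: (endpoint_le _ _ _ _ ylc xlc yl xl _ (congr1 (@lo R) (esym xy0))) => s sT.
  by have := loFG s sT; rewrite distrC; apply: le_trans; exact: ler_norm.
have hi2 : hi (y t) - hi (x t) <= psi t - psi 0.
  apply: (endpoint_le _ _ _ _ yhc xhc yh xh _ (congr1 (@hi R) (esym xy0))) => s sT.
  by have := hiFG s sT; rewrite distrC; apply: le_trans; exact: ler_norm.
move: lo1 hi1; rewrite /= => lo1 hi1.
by rewrite /itv_dist ge_max !ler_norml; apply/andP; split; apply/andP; split; lra.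
Qed.

Definition clamp (t : R) : R := Num.max 0 (Num.min t T).

Lemma clamp_id t : 0 <= t <= T -> clamp t = t.
Proof. by move=> /andP[t0 tT]; rewrite /clamp (min_idPl tT) (max_idPr t0). Qed.

Lemma clamp_in t : 0 <= clamp t <= T.
Proof.
by rewrite /clamp le_max lexx ge_max (ltW T_gt0) ge_min lexx orbT.
Qed.

(** Precomposing with the retraction onto [0, T] turns continuity on [0, T]
    into continuity on the line, where primitives are available. *)
Lemma clamp_continuous (V : topologicalType) (g : R -> V) :
  {within `[0, T], continuous g} -> continuous (g \o clamp).
Proof.
move=> /subspace_continuousP gc t.
have ct : clamp s @[s --> t] --> clamp t.
  apply/cvgrPdist_lt => e e0; near=> s.
  have ts : `|t - s| < e by near: s; exact: (nbhsx_ballx t e e0).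
  move: ts; rewrite !ltr_norml /clamp => /andP[ts1 ts2].
  by case: (leP s T); case: (leP t T); case: (leP 0 s); case: (leP 0 t);
    case: (leP 0 T) => *; apply/andP; split; lra.
apply: cvg_comp (gc _ _); last by rewrite /= in_itv /= clamp_in.
move=> A /= wA.
have : nbhs t [set s | `[0, T]%classic (clamp s) -> A (clamp s)] := ct _ wA.
by apply: (@filterS _ (nbhs t)) => s /= sA; apply: sA; rewrite in_itv /= clamp_in.
Unshelve. all: by end_near. Qed.

(** The endpoints of the primitive are primitives of the endpoints. The width
    is then nondecreasing on [0, T], because its derivative is a width; this
    gives both that the endpoints are ordered and that the Hukuhara differences
    exist. *)
Lemma iprimitive_exists F (x0 : cintv R) :
  {within `[0, T], continuous F} ->
  exists2 x : R -> cintv R, x 0 = x0 &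
    forall t, 0 <= t <= T -> is_iderive_on T x t (F t).
Proof.
move=> /clamp_continuous Fc.
have [Gl Gl0 Gld] := @primitive_exists _ (@lo R \o (F \o clamp))
  (fun t => continuous_comp (Fc t) (@lo_continuous R _)).
have [Gh Gh0 Ghd] := @primitive_exists _ (@hi R \o (F \o clamp))
  (fun t => continuous_comp (Fc t) (@hi_continuous R _)).
have gap_mono s t : 0 <= s -> s <= t -> t <= T -> Gh s - Gl s <= Gh t - Gl t.
  have gd r : 0 < r < T -> is_derive r 1 (Gh - Gl)
      (hi (F (clamp r)) - lo (F (clamp r))).
    by move=> /andP[/ltW r0 _]; exact: is_deriveB (Ghd r r0) (Gld r r0).
  apply: (le_of_derive_ge0 gd); first by move=> r _; rewrite subr_ge0 lo_le_hi.
  apply: derivable_within_continuous => r; rewrite in_itv /= => /andP[r0 _].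
  by apply: derivableB; [have [] := Ghd r r0|have [] := Gld r r0].
(* Clamping keeps the endpoints ordered at every real t: before 0 the width of
   the primitive may drop below 0. *)
have x_le t : lo x0 + Gl (clamp t) <= hi x0 + Gh (clamp t).
  have /andP[c0 cT] := clamp_in t.
  by have := gap_mono 0 (clamp t) (lexx 0) c0 cT; have := lo_le_hi x0; lra.
pose x t := mk_itv (x_le t).
have xE t : 0 <= t <= T -> lo (x t) = lo x0 + Gl t /\ hi (x t) = hi x0 + Gh t.
  by move=> tT; rewrite /lo /hi /= clamp_id.
have T0 : 0 <= (0 : R) <= T by rewrite lexx ltW.
exists x; first by have [? ?] := xE 0 T0; apply: itv_eqP; lra.
move=> t tT; have /andP[t0 tleT] := tT.
have [xtl xth] := xE t tT.
have [Glr Gll] := quot_of_is_derive (Gld t t0).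
have [Ghr Ghl] := quot_of_is_derive (Ghd t t0).
rewrite /= clamp_id// in Glr Gll Ghr Ghl.
split=> ht.
  have xth' : \forall h \near 0^'+, 0 < h /\ 0 <= t + h <= T.
    have Tt : 0 < T - t by lra.
    by apply: filterS2 (nbhs_right_gt 0) (nbhs_right_lt Tt) => h h0 hT; split; lra.
  have ex : \forall h \near 0^'+, hdiff_exists (x (t + h)) (x t).
    apply: filterS xth' => h [h0 hT]; apply/hdiff_existsP.
    have [-> ->] := xE _ hT; rewrite xtl xth.
    have := gap_mono t (t + h) t0 _ _; rewrite lerDl (ltW h0).
    by case/andP: hT => _ -> /(_ isT isT); lra.
  split=> //; apply/hdiff_quot_cvgP => //; split.
    apply: cvg_trans Glr; apply: near_eq_cvg; apply: filterS xth' => h [_ hT].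
    by have [-> _] := xE _ hT; rewrite xtl; congr (_ * _); ring.
  apply: cvg_trans Ghr; apply: near_eq_cvg; apply: filterS xth' => h [_ hT].
  by have [_ ->] := xE _ hT; rewrite xth; congr (_ * _); ring.
have xth' : \forall h \near 0^'+, 0 < h /\ 0 <= t - h <= T.
  by apply: filterS2 (nbhs_right_gt 0) (nbhs_right_lt ht) => h h0 hT; split; lra.
have ex : \forall h \near 0^'+, hdiff_exists (x t) (x (t - h)).
  apply: filterS xth' => h [h0 hT]; apply/hdiff_existsP.
  have [-> ->] := xE _ hT; rewrite xtl xth.
  have := gap_mono (t - h) t _ _ tleT; rewrite gerBl (ltW h0).
  by case/andP: hT => -> _ /(_ isT isT); lra.
split=> //; apply/hdiff_quot_cvgP => //; split.
  apply: cvg_trans Gll; apply: near_eq_cvg; apply: filterS xth' => h [_ hT].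
  by have [-> _] := xE _ hT; rewrite xtl; congr (_ * _); ring.
apply: cvg_trans Ghl; apply: near_eq_cvg; apply: filterS xth' => h [_ hT].
by have [_ ->] := xE _ hT; rewrite xth; congr (_ * _); ring.
Qed.

End IntervalDerivatives.

(** * Trajectories: stability and existence *)

Section Dynamics.
Context {R : realType} {n : nat} (T : R) (T_gt0 : 0 < T).
Variables (f : R -> cintv R -> 'rV[R]_n -> cintv R) (x0 : cintv R) (k1 k2 : R).
Hypothesis f_cont : {within txu_dom T, continuous (uncurry3 f)}.
Hypotheses (k1_gt0 : 0 < k1) (k2_gt0 : 0 < k2).
Hypothesis f_lip : forall (t : R) (x1 x2 : cintv R) (u1 u2 : 'rV[R]_n),
  0 <= t <= T ->
  itv_dist (f t x1 u1) (f t x2 u2) <=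
  k1 * itv_dist x1 x2 + k2 * euclid_norm (u1 - u2).
Implicit Types (x y F G : R -> cintv R) (u v : R -> 'rV[R]_n).

(** The rate 2 k1, twice the Lipschitz constant of the dynamics, is what gives
    the factor 1/2 in [weighted_contraction]. *)
Definition weight (t : R) : R := expR (2 * k1 * t).

Lemma weight_ge1 t : 0 <= t -> 1 <= weight t.
Proof. by move=> t0; rewrite -expR0 ler_expR !mulr_ge0// ltW. Qed.

Lemma weight_le t : t <= T -> weight t <= weight T.
Proof. by move=> tT; rewrite ler_expR ler_wpM2l// mulr_ge0// ltW. Qed.

(** The bound on the derivatives is the derivative of
    S / 2 * weight t + c t, so the mean value inequality applies to it. The
    term c accounts for a perturbation of the control. *)
Lemma weighted_contraction x y F G (S c : R) : 0 <= S -> 0 <= c ->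
  (forall t, 0 <= t <= T -> is_iderive_on T x t (F t)) ->
  (forall t, 0 <= t <= T -> is_iderive_on T y t (G t)) ->
  x 0 = y 0 ->
  (forall t, 0 <= t <= T -> itv_dist (F t) (G t) <= k1 * (S * weight t) + c) ->
  forall t, 0 <= t <= T -> itv_dist (x t) (y t) <= S / 2 * weight t + c * T.
Proof.
move=> S0 c0 xF yG xy0 FG t tT.
pose psi (s : R) := S / 2 * weight s + c * s.
have psid (s : R) : is_derive s 1 psi (k1 * (S * weight s) + c).
  have lin (a : R) : is_derive s 1 (fun r => a * r) a.
    by have := is_deriveZ a (is_derive_id s 1); rewrite /GRing.scale/= mulr1.
  have wd : is_derive s 1 weight (weight s * (2 * k1)).
    exact: is_derive1_comp (is_derive_expR _) (lin (2 * k1)).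
  apply: is_derive_eq (is_deriveD (is_deriveZ (S / 2) wd) (lin c)) _.
  by rewrite /GRing.scale /=; field.
have := dist_le_of_iderive xF yG xy0 psid FG tT.
rewrite /psi [weight 0]/weight mulr0 expR0 => /le_trans; apply.
have /andP[t0 tleT] := tT.
have := ler_wpM2l c0 tleT; lra.
Qed.

Lemma itv_dist_bounded x y :
  {within `[0, T], continuous x} -> {within `[0, T], continuous y} ->
  exists2 M, 0 <= M & forall t, 0 <= t <= T -> itv_dist (x t) (y t) <= M.
Proof.
move=> xc yc.
pose g t := `|lo (x t) - lo (y t)| + `|hi (x t) - hi (y t)|.
have gc : {within `[0, T], continuous g}.
  have comp_c (e : cintv R -> R) z : continuous e ->
      {within `[0, T], continuous z} -> {within `[0, T], continuous (e \o z)}.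
    by move=> ec zc t; exact: continuous_comp (zc t) (ec _).
  have diff_c (e : cintv R -> R) : continuous e ->
      {within `[0, T], continuous (fun t => `|e (x t) - e (y t)|)}.
    move=> ec t; apply: cvg_norm.
    by apply: cvgB; [exact: (comp_c _ _ ec xc t)|exact: (comp_c _ _ ec yc t)].
  move=> t; apply: cvgD; first exact: (diff_c _ lo_continuous t).
  exact: (diff_c _ hi_continuous t).
have [c _ cmax] := EVT_max (ltW T_gt0) gc.
exists (g c) => [|t tT]; first by rewrite addr_ge0.
apply: le_trans (cmax t _); last by rewrite in_itv.
by rewrite /itv_dist ge_max lerDl lerDr !normr_ge0.
Qed.

Lemma field_continuous x u : {within `[0, T], continuous x} -> Uad T u ->
  {within `[0, T], continuous (fun t => f t (x t) (u t))}.
Proof.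
move=> /subspace_continuousP xc /subspace_continuousP uc.
apply/subspace_continuousP => t tT.
have tT' : 0 <= t <= T by rewrite /= in_itv in tT.
have pc : (s, x s, u s) @[s --> within `[0, T] (nbhs t)] --> (t, x t, u t).
  have tx_c : (s, x s) @[s --> within `[0, T] (nbhs t)] --> (t, x t).
    apply: (@cvg_pair _ _ _ _ (nbhs t) (nbhs (x t))); last exact: xc.
    exact: cvg_within.
  by apply: (@cvg_pair _ _ _ _ (nbhs (t, x t)) (nbhs (u t))); last exact: uc.
move/subspace_continuousP : f_cont => /(_ (t, x t, u t) tT') fc.
move=> A /fc fA.
have {fA}/pc : nbhs (t, x t, u t) [set p | txu_dom T p -> A (uncurry3 f p)] := fA.
rewrite /nbhs /= /within /=; apply: filterS => s sA sT.
by apply: (sA sT); rewrite /txu_dom /= in_itv in sT *.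
Qed.

Lemma solution_continuous u x : is_solution T f x0 u x ->
  {within `[0, T], continuous x}.
Proof. by move=> [_ xf]; exact: iderive_continuous xf. Qed.

(** Gronwall's inequality, obtained by iterating [weighted_contraction]: a
    bound (M 2^-k + B) weight with B = 2 k2 d T improves to the same bound for
    k + 1. With d = 0 it gives uniqueness on [0, T], so there [trajectory] does
    not depend on a choice of solution. *)
Lemma solution_stability u v x y (d : R) : Uad T u -> Uad T v ->
  is_solution T f x0 u x -> is_solution T f x0 v y ->
  (forall t, 0 <= t <= T -> euclid_norm (u t - v t) <= d) ->
  forall t, 0 <= t <= T -> itv_dist (x t) (y t) <= 2 * k2 * T * weight T * d.
Proof.
move=> uU vU xs ys uv.
have d0 : 0 <= d.
  by apply: le_trans (uv 0 _); rewrite ?euclid_norm_ge0// lexx ltW.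
have [M M0 xyM] := itv_dist_bounded (solution_continuous xs) (solution_continuous ys).
set B := 2 * (k2 * d * T).
have B0 : 0 <= B by rewrite !mulr_ge0// ltW.
have bound k t : 0 <= t <= T ->
    itv_dist (x t) (y t) <= (M * 2^-1 ^+ k + B) * weight t.
  elim: k t => [|k ih] t tT; have /andP[t0 _] := tT; have w1 := weight_ge1 t0.
    rewrite expr0 mulr1; apply: le_trans (xyM t tT) _.
    have := ler_wpM2l M0 w1; have : 0 <= B * weight t by rewrite mulr_ge0//; lra.
    lra.
  have S0 : 0 <= M * 2^-1 ^+ k + B by rewrite addr_ge0// mulr_ge0// exprn_ge0 ?invr_ge0.
  have c0 : 0 <= k2 * d by rewrite mulr_ge0// ltW.
  have FG s : 0 <= s <= T -> itv_dist (f s (x s) (u s)) (f s (y s) (v s)) <=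
      k1 * ((M * 2^-1 ^+ k + B) * weight s) + k2 * d.
    move=> sT; apply: le_trans (f_lip _ _ _ _ sT) _; apply: lerD.
      by rewrite ler_pM2l//; exact: ih.
    by rewrite ler_pM2l//; exact: uv.
  apply: le_trans (weighted_contraction S0 c0 xs.2 ys.2 _ FG tT) _.
    by rewrite xs.1 ys.1.
  have /(ler_wpM2l B0) : 1 <= weight t by [].
  rewrite exprS /B; lra.
move=> t tT; apply/ler_addgt0Pr => e e0.
have /andP[t0 tleT] := tT.
have [k _ /(_ k (leqnn k)) /= Mk] := geo_small (M * weight T) e0.
apply: le_trans (bound k t tT) _.
have Mk0 : 0 <= M * 2^-1 ^+ k + B by rewrite addr_ge0// mulr_ge0// exprn_ge0 ?invr_ge0.
apply: le_trans (ler_wpM2l Mk0 (weight_le tleT)) _.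
by rewrite /B; lra.
Qed.

Lemma geo_rate_gt0 (C : R) (k : nat) : 0 < C -> 0 < C * 2^-1 ^+ k.
Proof. by move=> C0; rewrite mulr_gt0// exprn_gt0 ?invr_gt0. Qed.

(** The limit is built from the limits of the endpoints, whose order persists;
    clamping makes it an interval at every real t. *)
Lemma uniform_limit_itv (X : nat -> R -> cintv R) (C : R) : 0 < C ->
  (forall k m t, (k <= m)%N -> 0 <= t <= T ->
     itv_dist (X k t) (X m t) < C * 2^-1 ^+ k) ->
  (forall k, {within `[0, T], continuous (X k)}) ->
  exists2 x, continuous x & forall k t, 0 <= t <= T ->
    itv_dist (X k t) (x t) <= 2 * C * 2^-1 ^+ k.
Proof.
move=> C0 Xcauchy Xcont.
have endpoint_lim (e : cintv R -> R) : continuous e ->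
    (forall A B, `|e A - e B| <= itv_dist A B) ->
    exists2 g : R -> R, {within `[0, T], continuous g} &
      forall k t, 0 <= t <= T -> `|e (X k t) - g t| <= 2 * C * 2^-1 ^+ k.
  move=> ec e_dist.
  have [|d d0|k m t km tT|k|g gc Xg] := @uniform_limit_within R R `[0, T]
    (fun k => e \o X k) (fun k => C * 2^-1 ^+ k).
  - by move=> k; exact: geo_rate_gt0.
  - exact: geo_small.
  - have tT' : 0 <= t <= T by rewrite /= in_itv in tT.
    exact: le_lt_trans (e_dist _ _) (Xcauchy k m t km tT').
  - by move=> t; exact: continuous_comp (Xcont k t) (ec _).
  exists g => // k t tT.
  have tT' : `[0, T]%classic t by rewrite /= in_itv.
  by have := Xg k t tT'; rewrite /ball /= => /ltW; rewrite -mulrDl -mulr2n mulr_natl.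
have [gl glc Xgl] := endpoint_lim _ lo_continuous lo_dist.
have [gh ghc Xgh] := endpoint_lim _ hi_continuous hi_dist.
have x_le t : gl (clamp T t) <= gh (clamp T t).
  apply/ler_addgt0Pr => e e0.
  have [k _ /(_ k (leqnn k)) /=] := geo_small (2 * C + 2 * C) e0.
  have cT := clamp_in T_gt0 t.
  have := Xgl k _ cT; have := Xgh k _ cT; have := lo_le_hi (X k (clamp T t)).
  by rewrite !ler_norml => ? /andP[? ?] /andP[? ?] ?; lra.
exists (fun t => mk_itv (x_le t)).
  move=> t; apply/cvg_itvP; split.
    exact: clamp_continuous T_gt0 _ _ glc t.
  exact: clamp_continuous T_gt0 _ _ ghc t.
move=> k t tT; rewrite /itv_dist ge_max /lo /hi /= -/(lo _) -/(hi _) clamp_id//.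
by rewrite Xgl// Xgh.
Qed.

(** Picard iteration. The map P sends a continuous x to a primitive of
    f(t, x t, u t) starting at x0; it halves weighted distances, so its
    iterates converge geometrically, and P fixes the limit on [0, T]. Since
    x and P x may differ outside [0, T], the solution returned is P x. *)
Lemma solution_exists u : Uad T u -> exists x, is_solution T f x0 u x.
Proof.
move=> uU.
pose step_spec (x y : R -> cintv R) := {within `[0, T], continuous x} ->
  y 0 = x0 /\ forall t, 0 <= t <= T -> is_iderive_on T y t (f t (x t) (u t)).
have [P PP] : exists P : (R -> cintv R) -> R -> cintv R, forall x, step_spec x (P x).
  have h x : exists y, step_spec x y.
    have [xc|nxc] := pselect {within `[0, T], continuous x}; last by exists x.
    have [y y0 yf] := iprimitive_exists T_gt0 x0 (field_continuous xc uU).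
    by exists y.
  by exists (fun x => sval (cid (h x))) => x; exact: svalP (cid (h x)).
have Pc x : {within `[0, T], continuous x} -> {within `[0, T], continuous (P x)}.
  by move=> /PP[_ Pf]; exact: iderive_continuous Pf.
have P_contr x y S : 0 <= S ->
    {within `[0, T], continuous x} -> {within `[0, T], continuous y} ->
    (forall t, 0 <= t <= T -> itv_dist (x t) (y t) <= S * weight t) ->
    forall t, 0 <= t <= T -> itv_dist (P x t) (P y t) <= S / 2 * weight t.
  move=> S0 xc yc xy t tT; rewrite -[leRHS]addr0 -[X in _ + X](mul0r T).
  have [[Px0 Pxf] [Py0 Pyf]] := (PP x xc, PP y yc).
  apply: (weighted_contraction S0 (lexx 0) Pxf Pyf _ _ tT); first by rewrite Px0.
  move=> s sT; rewrite addr0; apply: le_trans (f_lip _ _ _ _ sT) _.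
  by rewrite subrr euclid_norm0 mulr0 addr0 ler_pM2l// xy.
pose X k := iter k P (fun=> x0).
have Xc k : {within `[0, T], continuous (X k)}.
  elim: k => [|k ih]; last exact: Pc.
  by apply: continuous_subspaceT => t; exact: cvg_cst.
have [M M0 XM] := itv_dist_bounded (Xc 0%N) (Xc 1%N).
have Xstep k t : 0 <= t <= T ->
    itv_dist (X k t) (X k.+1 t) <= M * 2^-1 ^+ k * weight t.
  elim: k t => [|k ih] t tT.
    rewrite expr0 mulr1; apply: le_trans (XM t tT) _.
    by have /andP[t0 _] := tT; have := ler_wpM2l M0 (weight_ge1 t0); lra.
  have S0 : 0 <= M * 2^-1 ^+ k by rewrite mulr_ge0// exprn_ge0 ?invr_ge0.
  have := P_contr _ _ _ S0 (Xc k) (Xc k.+1) ih t tT.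
  by rewrite [2^-1 ^+ k.+1]exprSr mulrA.
(* The difference of geometric terms makes the telescoping an induction. *)
have Xdist k m t : (k <= m)%N -> 0 <= t <= T ->
    itv_dist (X k t) (X m t) <= 2 * M * (2^-1 ^+ k - 2^-1 ^+ m) * weight t.
  move=> km tT; elim: m km => [|m ih].
    by rewrite leqn0 => /eqP ->; rewrite itv_distxx subrr mulr0 mul0r.
  rewrite leq_eqVlt => /predU1P[->|].
    by rewrite itv_distxx subrr mulr0 mul0r.
  rewrite ltnS => /ih km.
  apply: le_trans (itv_dist_triangle (X m t) _ _) _.
  by have := Xstep m t tT; rewrite [2^-1 ^+ m.+1]exprS; lra.
(* M + 1 instead of M makes the Cauchy bound strict, as open balls demand. *)
pose C := 2 * (M + 1) * weight T.
have wT : 1 <= weight T by rewrite weight_ge1 ?ltW.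
have C0 : 0 < C by rewrite /C !mulr_gt0//; lra.
have geo0 k : 0 < 2^-1 ^+ k :> R by rewrite exprn_gt0 ?invr_gt0.
have [|||x xcont Xx] := @uniform_limit_itv X C.
- exact: C0.
- move=> k m t km tT; apply: le_lt_trans (Xdist k m t km tT) _.
  have /andP[t0 tleT] := tT.
  have h1 : 2 * M * (2^-1 ^+ k - 2^-1 ^+ m) <= 2 * M * 2^-1 ^+ k.
    by rewrite ler_wpM2l ?mulr_ge0// gerBl ltW.
  have h2 : 2 * M * 2^-1 ^+ k < 2 * (M + 1) * 2^-1 ^+ k by rewrite ltr_pM2r//; lra.
  have w0 : 0 <= weight t by rewrite ltW// expR_gt0.
  apply: le_lt_trans (ler_wpM2r w0 h1) _.
  apply: le_lt_trans (_ : _ <= 2 * M * 2^-1 ^+ k * weight T) _.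
    by apply: ler_wpM2l (weight_le tleT); rewrite !mulr_ge0// ltW.
  rewrite /C -[ltRHS]mulrA [weight T * 2^-1 ^+ k]mulrC mulrA ltr_pM2r//.
  exact: lt_le_trans ltr01 wT.
- exact: Xc.
have xc : {within `[0, T], continuous x} by exact: continuous_subspaceT.
have x_fix t : 0 <= t <= T -> P x t = x t.
  move=> tT; apply: itv_dist_positivity; apply/eqP; rewrite eq_le.
  apply/andP; split; last by rewrite (le_trans _ (lo_dist _ _))//.
  apply/ler_addgt0Pr => e e0; rewrite add0r.
  have [k _ /(_ k (leqnn k)) /= Ck] := geo_small (2 * C * weight T) e0.
  have S0 : 0 <= 2 * C * 2^-1 ^+ k.
    exact: mulr_ge0 (mulr_ge0 (ler0n _ _) (ltW C0)) (ltW (geo0 k)).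
  have Xx_w s : 0 <= s <= T -> itv_dist (X k s) (x s) <= 2 * C * 2^-1 ^+ k * weight s.
    move=> sT; apply: le_trans (Xx k s sT) _.
    by have /andP[s0 _] := sT; rewrite ler_peMr// weight_ge1.
  have d1 : itv_dist (X k.+1 t) (P x t) <= _ := P_contr _ _ _ S0 (Xc k) xc Xx_w t tT.
  have d2 := Xx k.+1 t tT.
  have := itv_dist_triangle (X k.+1 t) (P x t) (x t).
  rewrite [itv_dist (P x t) (X k.+1 t)]itv_dist_sym.
  have /andP[t0 tleT] := tT.
  have := ler_wpM2l S0 (weight_le tleT).
  have := ler_wpM2l S0 wT.
  by rewrite exprS in d2; lra.
have [Px0 Pxf] := PP x xc.
by exists (P x); split => // t tT; rewrite x_fix//; exact: Pxf.
Qed.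

End Dynamics.

(** * Upper endpoint of the Aumann integral *)

Section AumannIntegral.
Context {R : realType} (a b : R) (g : R -> cintv R).
Hypotheses (g_meas : itv_measurable_on a b g)
  (g_bounded : itv_integrably_bounded_on a b g).

Let D : set (@lebR R) := `[a, b].

(** Measurability of g at the closed set of all reals says that [a, b] itself
    is measurable in the Lebesgue sigma-algebra. *)
Lemma measurable_domain : measurable D.
Proof.
have := g_meas closedT; congr (measurable _); apply/seteqP; split => t /=.
  by rewrite /D /= in_itv => -[].
rewrite /D /= in_itv /= => tab; split => //; exists (lo (g t)).
by split => //; rewrite /itv_set /= lexx lo_le_hi.
Qed.

(** g(t) meets [r, +oo[ iff hi g(t) >= r. *)
Lemma measurable_hi : measurable_fun D (@hi R \o g : lebR -> R).
Proof.
apply: (measurability (@RGenCInfty.G R)).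
  exact: RGenCInfty.measurableE.
move=> _ [_ [r ->] <-].
have := g_meas (@closed_ge _ r); congr (measurable _); apply/seteqP; split => t /=.
  move=> [tab [y [/andP[_ yhi] ry]]]; split; first by rewrite /D /= in_itv.
  by rewrite in_itv /= andbT (le_trans ry).
rewrite /D /= !in_itv /= andbT => -[tab rt]; split => //.
by exists (hi (g t)); split => //; rewrite /itv_set /= lo_le_hi lexx.
Qed.

(** g(t) misses ]-oo, r] iff lo g(t) > r. *)
Lemma measurable_lo : measurable_fun D (@lo R \o g : lebR -> R).
Proof.
apply: (measurability (@RGenOInfty.G R)).
  exact: RGenOInfty.measurableE.
move=> _ [_ [r ->] <-].
have := measurableD measurable_domain (g_meas (@closed_le _ r)).
congr (measurable _); apply/seteqP; split => t /=.
  rewrite /D /= !in_itv /= andbT => -[tab nr]; split => //.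
  rewrite ltNge; apply/negP => lor; apply: nr; split => //.
  by exists (lo (g t)); split => //; rewrite /itv_set /= lexx lo_le_hi.
rewrite /D /= !in_itv /= andbT => -[tab rlo]; split => // -[_ [y [/andP[ylo _] yr]]].
by have := lt_le_trans rlo (le_trans ylo yr); rewrite ltxx.
Qed.

Lemma integrable_endpoint (e : cintv R -> R) :
  measurable_fun D (e \o g : lebR -> R) -> (forall A, itv_set A (e A)) ->
  lebesgue_integrable_on a b (e \o g).
Proof.
move=> em eA; have [k [k0 kint gk]] := g_bounded.
apply: (le_integrable measurable_domain _ _ kint).
  exact/measurable_EFinP.
move=> t; rewrite /D /= in_itv /= => tab.
by rewrite lee_fin (le_trans (gk t tab _ (eA _)))// ler_norm.
Qed.

Lemma integrable_hi : lebesgue_integrable_on a b (@hi R \o g).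
Proof.
apply: integrable_endpoint measurable_hi _ => A.
by rewrite /itv_set /= lo_le_hi lexx.
Qed.

Lemma integrable_lo : lebesgue_integrable_on a b (@lo R \o g).
Proof.
apply: integrable_endpoint measurable_lo _ => A.
by rewrite /itv_set /= lo_le_hi lexx.
Qed.

Lemma itv_set_inj (A B : cintv R) : itv_set A = itv_set B -> A = B.
Proof.
move=> AB.
have mem_lo (C : cintv R) : itv_set C (lo C).
  by rewrite /itv_set /= lexx lo_le_hi.
have mem_hi (C : cintv R) : itv_set C (hi C).
  by rewrite /itv_set /= lexx lo_le_hi.
have := mem_lo A; rewrite AB => /andP[h1 _].
have := mem_hi A; rewrite AB => /andP[_ h2].
have := mem_lo B; rewrite -AB => /andP[h3 _].
have := mem_hi B; rewrite -AB => /andP[_ h4].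
by apply: itv_eqP; apply/eqP; rewrite eq_le ?h1 ?h2 ?h3 ?h4.
Qed.

(** Every integrable selection has its integral between those of the endpoint
    functions; conversely, the convex combinations of the endpoint functions
    with constant weights are selections whose integrals fill that interval. *)
Lemma hi_aumann_integral :
  hi (aumann_integral a b g) = lebesgue_integral_on a b (@hi R \o g).
Proof.
pose il := lebesgue_integral_on a b (@lo R \o g).
pose ih := lebesgue_integral_on a b (@hi R \o g).
have il_ih : il <= ih.
  apply: (le_Rintegral measurable_domain integrable_lo integrable_hi) => t _.
  exact: lo_le_hi.
suff J_set : itv_set (mk_itv il_ih) = aumann_set a b g.
  have E : itv_set (aumann_integral a b g) = aumann_set a b g.
    exact: (@xgetPex _ _ [set J | itv_set J = aumann_set a b g]) (ex_intro _ _ J_set).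
  by rewrite -J_set in E; rewrite (itv_set_inj E).
apply/seteqP; split => r; last first.
  move=> [gamma [gint gsel ->]]; rewrite /itv_set /lo /hi /=; apply/andP; split.
    apply: (le_Rintegral measurable_domain integrable_lo gint) => t.
    by rewrite /D /= in_itv /= => /gsel /andP[].
  apply: (le_Rintegral measurable_domain gint integrable_hi) => t.
  by rewrite /D /= in_itv /= => /gsel /andP[].
rewrite /itv_set /lo /hi /= => /andP[lr rh].
have [th [th0 th1 rE]] : exists th, [/\ 0 <= th, th <= 1 &
    r = (1 - th) * il + th * ih].
  (* A degenerate interval leaves the weight arbitrary. *)
  have [E|ne] := eqVneq il ih; first by exists 0; split; lra.
  have pos : 0 < ih - il by rewrite subr_gt0 lt_neqAle ne.
  exists ((r - il) / (ih - il)); split.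
  - by rewrite divr_ge0 ?subr_ge0.
  - by rewrite ler_pdivrMr// mul1r lerD2r.
  - by field; rewrite gt_eqF.
have scale_int (c : R) (h : R -> R) : lebesgue_integrable_on a b h ->
    lebesgue_integrable_on a b (fun t => c * h t).
  by move=> hint; exact: (integrableZl measurable_domain c hint).
have lint := scale_int (1 - th) _ integrable_lo.
have hint := scale_int th _ integrable_hi.
exists (fun t => (1 - th) * lo (g t) + th * hi (g t)); split.
- exact: (integrableD measurable_domain lint hint).
- move=> t _; have := lo_le_hi (g t); rewrite /itv_set /= => lh.
  have th1' : 0 <= 1 - th by lra.
  have := ler_wpM2l th0 lh; have := ler_wpM2l th1' lh => ? ?.
  by apply/andP; split; lra.
- rewrite /lebesgue_integral_on RintegralD//; try exact: measurable_domain.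
  rewrite !RintegralZl//; try exact: measurable_domain.
    exact: integrable_hi.
  exact: integrable_lo.
Qed.

End AumannIntegral.

Lemma limn_einf_ge (R : realType) (u : nat -> \bar R) (l : R) :
  (forall e : R, 0 < e -> \forall k \near \oo, ((l - e)%:E <= u k)%E) ->
  (l%:E <= limn_einf u)%E.
Proof.
move=> ul; apply/lee_addgt0Pr => e e0.
rewrite -leeBlDr// -EFinB limn_einf_lim.
have [N _ NP] := ul e e0.
apply: lime_ge; first exact: is_cvg_einfs.
exists N => // m /= Nm; apply: le_ereal_inf_tmp => _ [p /= mp <-].
exact: NP (leq_trans Nm mp).
Qed.

Lemma limn_einf_le (R : realType) (u : nat -> \bar R) (c : \bar R) :
  (forall k, (u k <= c)%E) -> (limn_einf u <= c)%E.
Proof.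
move=> uc; rewrite limn_einf_lim.
apply: lime_le; first exact: is_cvg_einfs.
apply: nearW => k; apply: le_trans (uc k).
by apply: ereal_inf_lbound; exists k => /=.
Qed.

(** * Lower semicontinuity of the cost *)

(** The sublevel set of hi g at c is the order sublevel set of g at [c, c],
    since lo g <= hi g; its complement is a neighbourhood of q when
    c < hi (g q). *)
Lemma hi_lsc (R : realType) (M : topologicalType) (Y : set M)
    (g : M -> cintv R) (q : M) (e : R) :
  itv_lsc_on Y g -> Y q -> 0 < e ->
  \forall p \near q, Y p -> hi (g q) - e < hi (g p).
Proof.
move=> g_lsc Yq e0.
have cl := g_lsc (itv1 (hi (g q) - e)).
have : nbhs (q : subspace Y)
    (~` ([set y | itv_preceq (g y) (itv1 (hi (g q) - e))] : set (subspace Y))).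
  apply: open_nbhs_nbhs; split; first exact: closed_openC.
  by move=> -[_]; rewrite /hi /= -/(hi _); lra.
rewrite {1}/nbhs /= -nbhs_subspace_in// /within /=.
apply: (@filterS _ (nbhs q)) => p nle Yp.
rewrite ltNge; apply/negP => hle; apply: (nle Yp); split => //.
exact: le_trans (lo_le_hi _) hle.
Qed.

Section Cost.
Context {R : realType} {n : nat} (T : R) (T_gt0 : 0 < T).
Variables (f : R -> cintv R -> 'rV[R]_n -> cintv R) (x0 : cintv R) (k1 k2 : R).
Variable (L : R -> cintv R -> 'rV[R]_n -> cintv R).
Hypothesis f_cont : {within txu_dom T, continuous (uncurry3 f)}.
Hypotheses (k1_gt0 : 0 < k1) (k2_gt0 : 0 < k2).
Hypothesis f_lip : forall (t : R) (x1 x2 : cintv R) (u1 u2 : 'rV[R]_n),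
  0 <= t <= T ->
  itv_dist (f t x1 u1) (f t x2 u2) <=
  k1 * itv_dist x1 x2 + k2 * euclid_norm (u1 - u2).
Hypothesis L_int : forall (u : R -> 'rV[R]_n) (x : R -> cintv R),
  Uad T u -> is_solution T f x0 u x ->
  itv_measurable_on 0 T (fun t => L t (x t) (u t)) /\
  itv_integrably_bounded_on 0 T (fun t => L t (x t) (u t)).
Hypothesis L_lsc : itv_lsc_on (txu_dom T) (uncurry3 L).
Hypothesis L_ge0 : forall (t : R) (zeta : cintv R) (eta : 'rV[R]_n),
  0 <= t <= T -> itv_preceq (itv1 0) (L t zeta eta).
Implicit Types u v : R -> 'rV[R]_n.

Lemma trajectoryP u : Uad T u -> is_solution T f x0 u (trajectory T f x0 u).
Proof.
move=> uU.
have := solution_exists T_gt0 x0 f_cont k1_gt0 f_lip uU.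
exact: (@xgetPex _ _ [set x | is_solution T f x0 u x]).
Qed.

Let hiL u t := hi (L t (trajectory T f x0 u t) (u t)).

Lemma hiL_ge0 u t : 0 <= t <= T -> 0 <= hiL u t.
Proof. by move=> tT; have [] := L_ge0 (trajectory T f x0 u t) (u t) tT. Qed.

Let D : set (@lebR R) := `[0, T].

Lemma hi_costE u : Uad T u ->
  [/\ measurable D, measurable_fun D (EFin \o hiL u : lebR -> \bar R) &
    (hi (cost T f x0 L u))%:E = (\int[leb]_(t in D) (hiL u t)%:E)%E].
Proof.
move=> uU; have [Lm Lb] := L_int uU (trajectoryP uU).
have mD : measurable D by exact: measurable_domain Lm.
split=> //; first by apply/measurable_EFinP; exact: measurable_hi Lm.
have hint : leb.-integrable D (fun t => (hiL u t)%:E) := integrable_hi Lm Lb.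
by rewrite /cost (hi_aumann_integral Lm Lb) -(fineK (integrable_fin_num mD hint)).
Qed.

Lemma hi_cost_ge0 u : Uad T u -> 0 <= hi (cost T f x0 L u).
Proof.
move=> uU; have [_ _ costE] := hi_costE uU.
rewrite -lee_fin costE; apply: integral_ge0 => t.
by rewrite /D /= in_itv /= => tT; rewrite lee_fin hiL_ge0.
Qed.

(** Uniform convergence of the controls gives pointwise convergence of controls
    and, by stability, of trajectories; [hi_lsc] does the rest. *)
Lemma integrand_liminf (s : nat -> R -> 'rV[R]_n) u t :
  (forall k, Uad T (s k)) -> Uad T u ->
  (forall e, 0 < e -> \forall k \near \oo, Uad_norm T (u \- s k) < e) ->
  0 <= t <= T -> ((hiL u t)%:E <= limn_einf (fun k => (hiL (s k) t)%:E))%E.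
Proof.
move=> sU uU su tT; apply: limn_einf_ge => e e0.
have sut : s k t @[k --> \oo] --> u t.
  apply/cvgrPdist_lt => d d0; apply: filterS (su d d0) => k.
  apply: le_lt_trans; apply: le_trans (norm_le_euclid_norm _) _.
  exact: (le_Uad_norm T_gt0 (UadB uU (sU k)) tT).
have xt : trajectory T f x0 (s k) t @[k --> \oo] --> trajectory T f x0 u t.
  apply/cvg_ballP => d d0.
  set K := 2 * k2 * T * weight k1 T.
  have K0 : 0 < K by rewrite !mulr_gt0// expR_gt0.
  have dK : 0 < d / K by rewrite divr_gt0.
  apply: filterS (su _ dK) => k; rewrite ltr_pdivlMr// mulrC; apply: le_lt_trans.
  apply: (solution_stability T_gt0 k1_gt0 k2_gt0 f_lip uU (sU k)
    (trajectoryP uU) (trajectoryP (sU k)) _ tT) => r rT.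
  exact: (le_Uad_norm T_gt0 (UadB uU (sU k)) rT).
have pc : (t, trajectory T f x0 (s k) t, s k t) @[k --> \oo] -->
    (t, trajectory T f x0 u t, u t).
  have tx_c : (t, trajectory T f x0 (s k) t) @[k --> \oo] -->
      (t, trajectory T f x0 u t).
    apply: (@cvg_pair _ _ _ _ (nbhs t) (nbhs (trajectory T f x0 u t))); last exact: xt.
    exact: cvg_cst.
  by apply: (@cvg_pair _ _ _ _ (nbhs (t, trajectory T f x0 u t)) (nbhs (u t))).
have near_q := hi_lsc (q := (t, trajectory T f x0 u t, u t)) L_lsc tT e0.
apply: (@filterS _ \oo _ _ _ _ (pc _ near_q)) => k /(_ tT) /ltW.
by rewrite lee_fin.
Qed.

(** Fatou's lemma turns the pointwise inequality into one for the integrals.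
    It applies because (A4) makes the integrands nonnegative. *)
Lemma hi_cost_lsc (s : nat -> R -> 'rV[R]_n) u (c : R) :
  (forall k, Uad T (s k)) -> Uad T u ->
  (forall e, 0 < e -> \forall k \near \oo, Uad_norm T (u \- s k) < e) ->
  (forall k, hi (cost T f x0 L (s k)) <= c) -> hi (cost T f x0 L u) <= c.
Proof.
move=> sU uU su sc.
have [mD mu costE] := hi_costE uU.
rewrite -lee_fin costE.
have ms k : measurable_fun D (EFin \o hiL (s k) : lebR -> \bar R).
  by have [] := hi_costE (sU k).
have pos v t : D t -> (0 <= (hiL v t)%:E)%E.
  by rewrite /D /= in_itv /= => tT; rewrite lee_fin hiL_ge0.
have mlim : measurable_fun D (fun t => limn_einf (fun k => (hiL (s k) t)%:E)).
  apply: measurableT_comp => //; apply: measurable_fun_limn_esup => k.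
  exact: (measurableT_comp (@oppe_measurable R setT) (ms k)).
have int_le : (\int[leb]_(t in D) (hiL u t)%:E <=
    \int[leb]_(t in D) limn_einf (fun k => (hiL (s k) t)%:E))%E.
  apply: ge0_le_integral => //.
  - by move=> t; exact: pos.
  - move=> t; rewrite /D /= in_itv /= => tT; exact: integrand_liminf.
apply: le_trans int_le _; apply: le_trans (fatou leb mD ms (fun k t => pos (s k) t)) _.
apply: limn_einf_le => k.
by have [_ _ <-] := hi_costE (sU k); rewrite lee_fin.
Qed.

End Cost.

(** * Existence of epsilon-minimal solutions *)

Theorem theorem4p8 (R : realType) (n : nat) (T : R) (T_gt0 : 0 < T)
  (f : R -> cintv R -> 'rV[R]_n -> cintv R)
  (f_cont : {within txu_dom T, continuous (uncurry3 f)})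
  (x0 : cintv R)
  (L : R -> cintv R -> 'rV[R]_n -> cintv R)
  (L_int : forall (u : R -> 'rV[R]_n) (x : R -> cintv R),
     Uad T u -> is_solution T f x0 u x ->
     itv_measurable_on 0 T (fun t => L t (x t) (u t)) /\
     itv_integrably_bounded_on 0 T (fun t => L t (x t) (u t)))
  (A2 : exists k1 k2 : R, [/\ 0 < k1, 0 < k2 &
     forall (t : R) (x1 x2 : cintv R) (u1 u2 : 'rV[R]_n), 0 <= t <= T ->
       itv_dist (f t x1 u1) (f t x2 u2) <=
       k1 * itv_dist x1 x2 + k2 * euclid_norm (u1 - u2)])
  (A3 : itv_lsc_on (txu_dom T) (uncurry3 L))
  (A4 : forall (t : R) (zeta : cintv R) (eta : 'rV[R]_n), 0 <= t <= T ->
     itv_preceq (itv1 0) (L t zeta eta))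
  (eps : R) (eps_gt0 : 0 < eps) :
  exists u0 : R -> 'rV[R]_n, eps_minimal_solution T f x0 L eps u0.
Proof.
have [k1 [k2 [k1_gt0 k2_gt0 f_lip]]] := A2.
have [||u v uU vU|u v w uU vU wU|u _|s sU sC|u uU|s u c sU uU su sc|u0 u0U u0min] :=
  @ekeland R (R -> 'rV[R]_n) (Uad T) (fun u v => Uad_norm T (v \- u))
    (fun u => hi (cost T f x0 L u)) eps.
- exact: eps_gt0.
- by exists (fun=> 0); apply: continuous_subspaceT => t; exact: cvg_cst.
- by have := Uad_norm_ge0 T_gt0 (UadB vU uU).
- exact: Uad_norm_triangle.
- exact: Uad_norm_xx.
- by apply: (Uad_complete T_gt0 _ sU sC); rewrite invr_gt0.
- exact: hi_cost_ge0 f_cont k1_gt0 f_lip L_int A4 _ uU.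
- exact: hi_cost_lsc f_cont k1_gt0 k2_gt0 f_lip L_int A3 A4 _ _ _ sU uU su sc.
exists u0; split => // u uU [_].
by have := u0min u uU; rewrite /hi /= -!/(hi _) => h; rewrite ltNge h.
Qed.
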